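(* Let $\beta$ be a real number with $-1<\beta\le 2$ and $\beta\neq 0$. Let $T:[0,1]\to[0,1]$ be the piecewise fractional linear map with parameter $\beta$ and type $[\varepsilon_\alpha,\varepsilon_\beta,\varepsilon_\gamma]$ defined in the context, and let $S$ be its jump transformation, with inverse branches $V_{\alpha\beta}, V_\beta, V_{\gamma\beta}$. Then the following hold. (1) If $T$ is of type $[1,1,1]$, then $S$ has a natural dual, and (up to a multiplicative constant) the density of the invariant measure of $S$ is $$h(x)=\frac{1}{(2-\beta+3\beta x)(2+3\beta x)}.$$ (2) If $T$ is of type $[1,-1,1]$, then $S$ has a natural dual, and (up to a multiplicative constant) the density of the invariant measure of $S$ is $$h(x)=\frac{1}{(4+\beta+3\beta x)(4+3\beta x)}.$$
   Context: Maps. Use the partition $0<\frac13<\frac23<1$ of $[0,1]$. The map $T:[0,1]\to[0,1]$ is linear (affine) on $[0,\frac13]$ and on $[\frac23,1]$, each mapped onto $[\frac13,\frac23]$, and is non-linear fractional linear on $[\frac13,\frac23]$, which is mapped onto $[0,1]$ (values at the common endpoints are irrelevant). Signs $\varepsilon=1$ and $\varepsilon=-1$ indicate an increasing and a decreasing branch respectively, and the type of $T$ is $[\varepsilon_\alpha,\varepsilon_\beta,\varepsilon_\gamma]$, where $\alpha,\beta,\gamma$ refer to the branches on $[0,\frac13]$, $[\frac13,\frac23]$, $[\frac23,1]$. The letter $\beta$ is also used for a real parameter. The inverse branches $V_\alpha:[\frac13,\frac23]\to[0,\frac13]$, $V_\beta:[0,1]\to[\frac13,\frac23]$, $V_\gamma:[\frac13,\frac23]\to[\frac23,1]$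 of $T$ are: $V_\alpha x=\frac{-1+3x}{3}$ if $\varepsilon_\alpha=1$, and $V_\alpha x=\frac{2-3x}{3}$ if $\varepsilon_\alpha=-1$; $V_\beta x=\frac{1+(1+2\beta)x}{3+3\beta x}$ if $\varepsilon_\beta=1$, and $V_\beta x=\frac{2+(-1+\beta)x}{3+3\beta x}$ if $\varepsilon_\beta=-1$; $V_\gamma x=\frac{1+3x}{3}$ if $\varepsilon_\gamma=1$, and $V_\gamma x=\frac{4-3x}{3}$ if $\varepsilon_\gamma=-1$. The jump transformation $S:[0,1]\to[0,1]$ is defined by $S=T^2$ on $[0,\frac13]\cup[\frac23,1]$ and $S=T$ on $[\frac13,\frac23]$. Its three inverse branches, all defined on $[0,1]$, are $V_{\alpha\beta}=V_\alpha\circ V_\beta$, $V_\beta$, and $V_{\gamma\beta}=V_\gamma\circ V_\beta$, with images $[0,\frac13]$, $[\frac13,\frac23]$, $[\frac23,1]$. Natural dual. A fractional linear map $x\mapsto\frac{c+dx}{a+bx}$ is represented by the matrix $\begin{pmatrix} a & b \\ c & d \end{pmatrix}$ (determined up to a nonzero scalar factor), and $V^{*}$ denotes the transpose of the matrix $V$, so that $V^{*}y=\frac{b+dy}{a+cy}$. The map $S$ has a natural dual if there is an invertible symmetric real matrix $M=\begin{pmatrix} A & B \\ B & D \end{pmatrix}$, acting by $Mx=\frac{B+Dx}{A+Bx}$, such that $MV_i=V_i^{*}M$ for each $i\in\{\alpha\beta,\beta,\gamma\beta\}$; the natural dual is then $B^{*}=M[0,1]$ together with the three maps $V_i^{*}$.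 Invariant density. A function $h$ is the density of an invariant measure of $S$ if the measure $\nu(E)=\int_E h\,d\lambda$ ($\lambda$ Lebesgue measure on $[0,1]$) satisfies $\nu(S^{-1}E)=\nu(E)$ for all Borel sets $E\subseteq[0,1]$. The measure is not normalised and may be infinite.
   Formalization: In (1) with β<-2/3, h is negative to the right of a non-integrable pole at x=-2/(3β), so it is no density of a measure; h≥0 is claimed only for β≥-2/3, while the invariance identity for the integral of h (with ∞-∞ read as -∞) is claimed for all β. *)

(* Defs.v *)
(* MathComp / MathComp-Analysis *)
From mathcomp Require Import all_boot all_order all_algebra.
From mathcomp Require Import all_classical all_reals all_analysis.

Set Implicit Arguments.
Unset Strict Implicit.
Unset Printing Implicit Defensive.

Import Order.TTheory GRing.Theory Num.Theory.
Import numFieldNormedType.Exports.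

Local Open Scope classical_set_scope.
Local Open Scope ring_scope.

Definition mx2 (R : realType) (a b c d : R) : 'M[R]_2 :=
  \matrix_(i, j) if i == 0 then (if j == 0 then a else b)
                 else (if j == 0 then c else d).

(* The matrix (a b; c d) acts by x |-> (c + d x) / (a + b x), i.e. on column
   vectors (1, x)^T, so that [flmap (V *m W)] represents the composition
   [flmap V \o flmap W]. *)
Definition flmap (R : realType) (V : 'M[R]_2) (x : R) : R :=
  (V 1 0 + V 1 1 * x) / (V 0 0 + V 0 1 * x).

(* [Increasing] is the sign 1, [Decreasing] the sign -1. *)
Inductive sign := Increasing | Decreasing.

Record map_type := MapType
  { sgn_alpha : sign ; sgn_beta : sign ; sgn_gamma : sign }.

(* Matrices of the inverse branches of T. *)
Definition V_alpha (R : realType) (e : sign) : 'M[R]_2 :=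
  match e with
  | Increasing => mx2 3 0 (-1) 3
  | Decreasing => mx2 3 0 2 (-3)
  end.

Definition V_beta (R : realType) (beta : R) (e : sign) : 'M[R]_2 :=
  match e with
  | Increasing => mx2 3 (3 * beta) 1 (1 + 2 * beta)
  | Decreasing => mx2 3 (3 * beta) 2 (-1 + beta)
  end.

Definition V_gamma (R : realType) (e : sign) : 'M[R]_2 :=
  match e with
  | Increasing => mx2 3 0 1 3
  | Decreasing => mx2 3 0 4 (-3)
  end.

(* T and S are only meaningful on [0, 1].  The points 1/3 and 2/3 are assigned
   to the middle branch; T then maps [0, 1/3[ and ]2/3, 1] into [1/3, 2/3]. *)
Definition T_map (R : realType) (beta : R) (t : map_type) (x : R) : R :=
  if x < 1 / 3 then flmap (invmx (V_alpha R (sgn_alpha t))) x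
  else if x <= 2 / 3 then flmap (invmx (V_beta beta (sgn_beta t))) x
  else flmap (invmx (V_gamma R (sgn_gamma t))) x.

Definition S_map (R : realType) (beta : R) (t : map_type) (x : R) : R :=
  if (1 / 3 <= x) && (x <= 2 / 3) then T_map beta t x
  else T_map beta t (T_map beta t x).

(* V_{alpha beta}, V_beta, V_{gamma beta} *)
Definition S_inverse_branches (R : realType) (beta : R) (t : map_type) :
    seq 'M[R]_2 :=
  [:: V_alpha R (sgn_alpha t) *m V_beta beta (sgn_beta t);
      V_beta beta (sgn_beta t);
      V_gamma R (sgn_gamma t) *m V_beta beta (sgn_beta t)].

(* The equation M V = V^T M is homogeneous in V and in M, hence independent of
   the matrices chosen to represent the fractional linear maps.  M determines
   the dual: its domain is the image of [0, 1] under [flmap M] (with values on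
   the projective line), its inverse branches are the [flmap V^T]. *)
Definition has_natural_dual (R : realType) (Vs : seq 'M[R]_2) : Prop :=
  exists M : 'M[R]_2, [/\ M \in unitmx, M^T = M &
    forall V, V \in Vs -> M *m V = V^T *m M].

(* nu(S^-1 E) = nu(E) for every Borel set E of [0, 1], where nu has density h.
   The integrals may be infinite.  No sign is imposed on h here: that h >= 0,
   which makes nu a measure, is a separate assertion.  Indeed, for the type
   [1, 1, 1] and beta < -2/3 the density has a pole at the fixed point
   -2/(3 beta) of S in ]2/3, 1[ and is negative to the right of it. *)
Definition invariant_density (R : realType) (S h : R -> R) : Prop :=
  measurable_fun (`[0, 1] : set R) h /\
  forall E : set R, measurable E -> E `<=` `[0, 1] ->
    (\int[lebesgue_measure]_(x in (`[0%R, 1%R] : set R) `&` S @^-1` E) (h x)%:E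
     = \int[lebesgue_measure]_(x in E) (h x)%:E)%E.

(* Main.v *)
Require Import Defs.
From HB Require Import structures.
From mathcomp Require Import all_boot all_order all_algebra.
From mathcomp Require Import all_classical all_reals all_analysis.
From mathcomp Require Import measurable_realfun ring lra.

(** The three inverse branches of [S] are [V - 1/3], [V], [V + 1/3], where [V]
is the middle inverse branch of [T]: with both outer branches increasing, [T]
only translates the outer thirds onto the middle one.  Both densities have the
shape
<<
  h x = 1 / ((c + 3 beta x) (c + beta + 3 beta x)),   c = 2 - beta or c = 4,
>>
and a translation by [1/3] changes [c + 3 beta x] by exactly [beta].  Writing
[a = c - beta + 3 beta z], the values of [h] at [z - 1/3], [z], [z + 1/3] are
therefore [1 / (a (a + beta))], [1 / ((a + beta) (a + 2 beta))] and
[1 / ((a + 2 beta) (a + 3 beta))], whose sum telescopes to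
[3 / (a (a + 3 beta))].  For [z = V y] one of the affine factors of [h y] is
[(1 + beta y) a] and the other one is
[(1 + beta y) (a + 3 beta) / (1 + beta)]; as all branches have the same
Jacobian [(1 + beta) / (3 (1 + beta y)^2)], this is the transfer equation
[sum_i h (V_i y) |V_i' y| = h y].

The shape of [h] is the one which the natural dual predicts: the matrices [M]
below map [0] and [1] to [3 beta / (2 - beta)] (the point at infinity if
[beta = 2]) and [3 beta / 2] when the middle branch increases, and to
[3 beta / (4 + beta)] and [3 beta / 4] when it decreases; up to a factor, [h x]
is the integral of [1 / (1 + x y)^2] over [y] between these two points,
wherever this integral converges.

Passing from the transfer equation to invariance needs the change of variables
[x = V_i y] for arbitrary nonnegative measurable integrands
([ge0_integral_comp_increasing], [ge0_integral_comp_decreasing]).  It is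
obtained by identifying Lebesgue measure on the image interval with the image
under [V] of the measure of density [V'], the two agreeing on half-lines by the
fundamental theorem of calculus.

For [beta < -2/3] the density of type [[1, 1, 1]] changes sign at a
non-integrable pole, so that both its positive and negative parts may have
infinite integral and the transfer equation alone does not determine the
signed integrals.  What saves the conclusion
([invariant_density_of_branches]) is that cancellation between branches is
bounded: [sum_i (h (V_i y))^+ |V_i' y| <= (h y)^+ + C].  Hence passing from
[E] to its preimage adds one and the same finite amount to the integrals of
[h^+] and of [h^-], and their difference, finite or not, is unchanged. *)

Import Order.TTheory GRing.Theory Num.Theory.
Import numFieldNormedType.Exports.
Set Implicit Arguments.
Unset Strict Implicit.
Unset Printing Implicit Defensive.

Local Open Scope classical_set_scope.
Local Open Scope ring_scope.

(** * Measures with a density *)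

Section density.
Local Open Scope ereal_scope.
Context d (T : measurableType d) (R : realType).
Variable mu : {measure set T -> \bar R}.

(** The density is restricted to [D], where alone its measurability and its
sign are known; both are carried as arguments so that the measure structure
can be inferred. *)
Definition mdensity (D : set T) (J : T -> R) (mD : measurable D)
    (mJ : measurable_fun D J) (J0 : forall x, D x -> (0 <= J x)%R) (A : set T) :=
  \int[mu]_(x in D `&` A) (J x)%:E.

Variables (D : set T) (J : T -> R) (mD : measurable D).
Variables (mJ : measurable_fun D J) (J0 : forall x, D x -> (0 <= J x)%R).

Local Notation nu := (mdensity mD mJ J0).

Let nu0 : nu set0 = 0.
Proof. by rewrite /mdensity setI0 integral_set0. Qed.

Let nu_ge0 A : 0 <= nu A.
Proof. by apply: integral_ge0 => x [Dx _]; rewrite lee_fin J0. Qed.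

Let nu_sigma_additive : semi_sigma_additive nu.
Proof.
move=> F mF tF mUF; rewrite /mdensity setI_bigcupr ge0_integral_bigcup//=.
- by apply: is_cvg_ereal_nneg_natsum_cond => n _ _; exact: nu_ge0.
- by move=> k; exact: measurableI.
- rewrite -setI_bigcupr; apply/measurable_EFinP.
  by apply: measurable_funS mJ => //; exact: subIsetl.
- by move=> x [k _ [Dx _]]; rewrite lee_fin J0.
- exact: trivIset_setIl.
Qed.

HB.instance Definition _ := isMeasure.Build _ _ _ nu nu0 nu_ge0 nu_sigma_additive.

Import HBNNSimple.

Lemma ge0_integral_mdensity (A : set T) (f : T -> \bar R) :
  measurable A -> measurable_fun A f -> (forall x, A x -> 0 <= f x) ->
  \int[nu]_(x in A) f x = \int[mu]_(x in D `&` A) (f x * (J x)%:E).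
Proof.
move=> mA mf f0;
(* Monotone convergence reduces the claim to simple functions. *)
pose h := nnsfun_approx mA mf.
have mDA : measurable (D `&` A) by exact: measurableI.
have mJDA : measurable_fun (D `&` A) (EFin \o J).
  by apply/measurable_EFinP; apply: measurable_funS mJ => //; exact: subIsetl.
have -> : \int[nu]_(x in A) f x = limn (fun n => \int[nu]_(x in A) (h n x)%:E).
  rewrite -monotone_convergence//.
  - apply: eq_integral => x /[!inE] Ax; apply/esym/cvg_lim => //.
    exact: cvg_nnsfun_approx.
  - by move=> n; exact/measurable_EFinP/measurable_funTS.
  - by move=> n x _; rewrite lee_fin.
  - by move=> x _ m n mn; rewrite lee_fin; exact/lefP/nd_nnsfun_approx.
have -> : \int[mu]_(x in D `&` A) (f x * (J x)%:E) =
    limn (fun n => \int[mu]_(x in D `&` A) ((h n x)%:E * (J x)%:E)).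
  rewrite -monotone_convergence//.
  - apply: eq_integral => x /[!inE] -[Dx Ax]; apply/esym/cvg_lim => //.
    by apply: cvgeZr => //; exact: cvg_nnsfun_approx.
  - move=> n; apply: emeasurable_funM => //.
    exact/measurable_EFinP/measurable_funTS.
  - by move=> n x [Dx _]; rewrite mule_ge0// lee_fin// J0.
  - move=> x [Dx _] m n mn; rewrite lee_wpmul2r ?lee_fin ?J0//.
    exact/lefP/nd_nnsfun_approx.
congr (limn _); apply/funext => n.
have mind r : measurable_fun setT (fun x => (r * \1_(h n @^-1` [set r]) x)%:E).
  exact/measurable_EFinP/measurable_funM.
transitivity (\int[nu]_(x in A)
    (\sum_(y \in range (h n)) (y * \1_(h n @^-1` [set y]) x)%:E)).
  by apply: eq_integral => t _; rewrite fimfunE -fsumEFin.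
rewrite ge0_integral_fsum//; last 2 first.
  - by move=> y; exact: measurable_funTS (mind y).
  - by move=> y x _; exact: nnfun_muleindic_ge0.
transitivity (\int[mu]_(x in D `&` A) (\sum_(y \in range (h n))
    (y * \1_(h n @^-1` [set y]) x)%:E * (J x)%:E)); last first.
  apply: eq_integral => x _.
  rewrite -ge0_mule_fsuml => [|y]; last exact: nnfun_muleindic_ge0.
  by rewrite fsumEFin // -(fimfunE _ x).
rewrite ge0_integral_fsum//; last 2 first.
  - move=> y; apply: emeasurable_funM => //; exact: measurable_funTS (mind y).
  - by move=> y x [Dx _]; rewrite mule_ge0 ?lee_fin ?J0// -lee_fin nnfun_muleindic_ge0.
apply: eq_fsbigr => r rhn.
under eq_integral do rewrite EFinM.
rewrite integralZl_indic_nnsfun => //.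
under [RHS]eq_integral do rewrite EFinM -muleA.
rewrite ge0_integralZl//.
- under [in RHS]eq_integral do rewrite muleC.
  rewrite integral_indic// [in RHS](eq_integral ((EFin \o J) \_ (h n @^-1` [set r]))).
    rewrite -integral_mkcondr; congr (_ * _).
    by rewrite -setIA (setIC A).
  by move=> x _; rewrite epatch_indic.
- by apply: emeasurable_funM => //; exact/measurable_EFinP/measurable_funTS.
- by move=> t [Dt _]; rewrite mule_ge0 ?lee_fin ?J0.
- by move: rhn; rewrite inE => -[t _ <-]; rewrite lee_fin.
Qed.

End density.

(** * Change of variables on an interval *)

Section substitution.
Context {R : realType}.
Local Notation mu := (@lebesgue_measure R).
Local Open Scope ereal_scope.

(** The preimage of a half-line and its trace on the image interval are
intervals with corresponding endpoints.  When the half-line contains the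
whole image both are open at the left end; the boolean [c] records this. *)
Let superlevel (V : R -> R) (a b x : R) : (a < b)%R ->
  {within `[a, b], continuous V} -> {in `[a, b] &, {mono V : x y / (x <= y)%R}} ->
  exists w (c : bool), [/\ w \in `[a, b]%R,
    `]a, b[ `&` V @^-1` `[x, +oo[ = [set` Interval (BSide c w) (BLeft b)] &
    `]V a, V b[ `&` `[x, +oo[ = [set` Interval (BSide c (V w)) (BLeft (V b))]].
Proof.
move=> ab cV mV.
have aab : a \in `[a, b]%R by rewrite in_itv/= lexx ltW.
have bab : b \in `[a, b]%R by rewrite in_itv/= lexx ltW.
have mVlt : {in `[a, b] &, {mono V : x y / (x < y)%R}} by exact: leW_mono_in.
have oc y : y \in `]a, b[%R -> y \in `[a, b]%R by exact: subset_itv_oo_cc.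
have [xa|ax] := leP x (V a).
  exists a, false; split=> //.
  - apply/seteqP; split => y /=; first by case.
    move=> yab; split=> //; rewrite in_itv/= andbT (le_trans xa)//.
    by rewrite mV// ?oc//; move: yab; rewrite in_itv/= => /andP[/ltW].
  - apply/seteqP; split => y /=; first by case.
    move=> yab; split=> //; rewrite in_itv/= andbT (le_trans xa)//.
    by move: yab; rewrite in_itv/= => /andP[/ltW].
have [bx|xb] := leP (V b) x.
  exists b, true; split=> //; rewrite !set_itvco0.
  - apply/seteqP; split => y //= [yab]; rewrite in_itv/= andbT => xy.
    have := le_trans bx xy; rewrite mV// ?oc//.
    by move: yab; rewrite in_itv/= leNgt => /andP[_ ->].
  - apply/seteqP; split => y //= [+]; rewrite !in_itv/= andbT => /andP[_ yb] xy.
    by have := lt_le_trans yb (le_trans bx xy); rewrite ltxx.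
have VaVb : (V a <= V b)%R by rewrite mV// ltW.
have [|w wab Vwx] := @IVT R V a b x (ltW ab) cV.
  by rewrite (min_idPl VaVb) (max_idPr VaVb) !ltW.
exists w, true; subst x; split=> //.
- apply/seteqP; split => y /=.
    move=> [yab]; rewrite !in_itv/= andbT mV// ?oc// => ->.
    by move: yab; rewrite in_itv/= => /andP[].
  have aw : (a < w)%R by rewrite -mVlt.
  rewrite in_itv/= => /andP[wy yb].
  have yab : y \in `]a, b[%R by rewrite in_itv/= yb (lt_le_trans aw wy).
  by split=> //; rewrite in_itv/= andbT mV// oc.
- apply/seteqP; split => y /=; rewrite !in_itv/= !andbT.
    by move=> [/andP[_ ->] ->].
  by move=> /andP[wy ->]; split=> //; rewrite andbT (lt_le_trans ax wy).
Qed.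

(** Half-lines generate the Borel sets and are stable under intersection, so it
suffices that Lebesgue measure on the image and the image of the measure of
density [J] agree on them, which is the fundamental theorem of calculus on
the intervals found in [superlevel]. *)
Lemma ge0_integral_comp_increasing (V J : R -> R) (a b : R) (f : R -> \bar R) :
  (a < b)%R -> measurable_fun setT V ->
  (forall y : R, y \in `[a, b]%R -> is_derive y 1%R V (J y)) ->
  {within `[a, b], continuous J} -> {in `]a, b[, forall y, 0 < J y}%R ->
  measurable_fun `]V a, V b[ f -> (forall x, x \in `]V a, V b[%R -> 0 <= f x) ->
  \int[mu]_(x in `]V a, V b[) f x = \int[mu]_(y in `]a, b[) (f (V y) * (J y)%:E).
Proof.
move=> ab mV dV cJ J0 mf f0.
have dVab (y : R) : y \in `[a, b]%R -> derivable V y 1%R by move=> /dV[].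
have VJ (y : R) : y \in `[a, b]%R -> V^`()%classic y = J y.
  by move=> /dV dVy; rewrite derive1E; exact: derive_val.
have ctV (y : R) : y \in `[a, b]%R -> {for y, continuous V}.
  by move=> yab; exact/differentiable_continuous/derivable1_diffP/dVab.
have cV : {within `[a, b], continuous V}.
  apply: continuous_in_subspaceT => y; rewrite inE /= => yab.
  exact: ctV.
have mono : {in `[a, b] &, {mono V : x y / (x <= y)%R}}.
  apply: le_mono_in; apply: gtr0_derive1_lt_cc => // y yab.
    exact/dVab/subset_itv_oo_cc.
  by rewrite VJ ?J0//; exact: subset_itv_oo_cc.
have mJ : measurable_fun `]a, b[ J.
  apply: subspace_continuous_measurable_fun => //.
  by apply: continuous_subspaceW cJ; exact: subset_itv_oo_cc.
have J0' y : (`]a, b[%classic : set R) y -> (0 <= J y)%R by move=> /J0/ltW.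
have J_itv w c : w \in `[a, b]%R ->
    \int[mu]_(y in [set` Interval (BSide c w) (BLeft b)]) (J y)%:E =
    (V b)%:E - (V w)%:E.
  rewrite in_itv/= => /andP[aw]; rewrite le_eqVlt => /predU1P[->|wb].
    by case: c; rewrite set_itvE integral_set0 subee.
  have sub y : y \in `[w, b]%R -> y \in `[a, b]%R.
    by rewrite !in_itv/= => /andP[/(le_trans aw) -> ->].
  rewrite integral_itv_bndoo; last first.
    apply/measurable_EFinP; apply: measurable_funS mJ => // y /=.
    by rewrite !in_itv/= => /andP[/(le_lt_trans aw) -> ->].
  rewrite -(@integral_itv_bndoo _ _ _ _ true false); last first.
    apply/measurable_EFinP; apply: measurable_funS mJ => // y /=.
    by rewrite !in_itv/= => /andP[/(le_lt_trans aw) -> ->].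
  apply: continuous_FTC2 => //.
  - exact: continuous_subspaceW cJ.
  - split.
    + by move=> y yab; apply/dVab/sub/subset_itv_oo_cc.
    + by apply/cvg_at_right_filter/ctV/sub; rewrite in_itv/= lexx ltW.
    + by apply/cvg_at_left_filter/ctV/sub; rewrite in_itv/= lexx ltW.
  - by move=> y yab; apply/VJ/sub/subset_itv_oo_cc.
pose nu := mdensity mu (measurable_itv `]a, b[) mJ J0'.
have mV' : measurable_fun setT (V : measurableTypeR R -> measurableTypeR R)
  by exact: mV.
have [nuV nuVE] : exists m : {measure set (measurableTypeR R) -> \bar R},
    m = pushforward nu V :> (set _ -> _).
  unshelve eexists (pushforward nu (V : measurableTypeR R -> measurableTypeR R)).
    exact: mV'.
  by [].
pose muV : {measure set (measurableTypeR R) -> \bar R} :=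
  mrestr mu (measurable_itv `]V a, V b[).
have nuVmu A : measurable A -> muV A = nuV A.
  apply: (@measure_unique _ R (measurableTypeR R) (@RGenCInfty.G R)
    (fun k => `[(- k%:R)%R, +oo[%classic)).
  - exact: etrans (@RGenCInfty.measurableE R).
  - move=> _ _ [x ->] [y ->]; exists (Num.max x y).
    apply/seteqP; split=> z /=; rewrite !in_itv/= !andbT ge_max.
      by move=> [-> ->].
    by move=> /andP[].
  - by move=> k; eexists.
  - apply/seteqP; split=> // x _.
    exists (Num.truncn `|x|).+1 => //=; rewrite in_itv/= andbT lerNl.
    by rewrite (le_trans _ (ltW (truncnS_gt _)))// -normrN ler_norm.
  - move=> _ [x ->]; have [w [c [wab VE muE]]] := superlevel x ab cV mono.
    rewrite nuVE /pushforward /nu /mdensity VE J_itv// /muV /= /mrestr setIC muE.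
    rewrite lebesgue_measure_itv/= lte_fin.
    case: ifPn => //; rewrite -leNgt => VbVw.
    suff -> : w = b by rewrite subee.
    apply/eqP; rewrite eq_le; move: (wab); rewrite in_itv/= => /andP[_ -> /=].
    by rewrite -mono// in_itv/= lexx ltW.
  - move=> k; apply: (@le_lt_trans _ _ (mu `]V a, V b[)).
      by apply: le_measure; rewrite ?inE//; exact: measurableI.
    by rewrite lebesgue_measure_itv/=; case: ifP; rewrite ltry.
have nuE A : measurable A -> A `<=` `]V a, V b[ -> mu A = nuV A.
  by move=> mA AV; rewrite -nuVmu// /muV /= /mrestr setIidl.
rewrite (eq_measure_integral nuV)//= nuVE.
rewrite (ge0_integral_pushforward mV')//; last by move=> x /[!inE]; exact: f0.
have mono_lt : {in `[a, b] &, {mono V : x y / (x < y)%R}} by exact: leW_mono_in.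
have VD y : y \in `]a, b[%R -> V y \in `]V a, V b[%R.
  move=> yab; have yab' : y \in `[a, b]%R by exact: subset_itv_oo_cc.
  have aab : a \in `[a, b]%R by rewrite in_itv/= lexx ltW.
  have bab : b \in `[a, b]%R by rewrite in_itv/= lexx ltW.
  by move: yab; rewrite !in_itv/= !mono_lt.
rewrite ge0_integral_mdensity//=.
- congr (integral _ _ _); apply/setIidl => y /=; exact: VD.
- by rewrite -[X in measurable X]setTI; exact: mV.
- apply: (measurable_comp (F := `]V a, V b[%classic)) => //.
    by move=> _ [y + <-].
  exact: (measurable_funTS mV').
- by move=> x; exact: f0.
Qed.

Lemma ge0_integral_oppr (a b : R) (f : R -> \bar R) :
  measurable_fun `]a, b[ f -> (forall x, x \in `]a, b[%R -> 0 <= f x) ->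
  \int[mu]_(x in `]a, b[) f x = \int[mu]_(x in `](- b)%R, (- a)%R[) f (- x)%R.
Proof.
move=> mf f0.
have -> : `](- b)%R, (- a)%R[%classic =
    (-%R : measurableTypeR R -> measurableTypeR R) @^-1` `]a, b[%classic.
  by rewrite opp_preimage_itvbndbnd.
rewrite -ge0_integral_pushforward//=; last by move=> x /[!inE]; exact: f0.
by apply: eq_measure_integral => //= A mA AS; exact/esym/lebesgue_measureN.
Qed.

(** The increasing case applied to [- V] and to the reflected integrand. *)
Lemma ge0_integral_comp_decreasing (V J : R -> R) (a b : R) (f : R -> \bar R) :
  (a < b)%R -> measurable_fun setT V ->
  (forall y : R, y \in `[a, b]%R -> is_derive y 1%R V (J y)) ->
  {within `[a, b], continuous J} -> {in `]a, b[, forall y, J y < 0}%R ->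
  measurable_fun `]V b, V a[ f -> (forall x, x \in `]V b, V a[%R -> 0 <= f x) ->
  \int[mu]_(x in `]V b, V a[) f x =
  \int[mu]_(y in `]a, b[) (f (V y) * (- J y)%:E).
Proof.
move=> ab mV dV cJ J0 mf f0; rewrite ge0_integral_oppr//.
have dVN (y : R) : y \in `[a, b]%R -> is_derive y 1%R (fun y => - V y)%R (- J y)%R.
  by move=> yab; have := dV y yab => ?; exact: is_deriveN.
apply: etrans.
  apply: (ge0_integral_comp_increasing ab _ dVN) => //.
  - exact: measurableT_comp.
  - by move=> y; apply: cvgN; exact: cJ.
  - by move=> y yab; rewrite oppr_gt0 J0.
  - apply: (measurable_comp (F := `]V b, V a[%classic)) => //.
    move=> _ [x xI <-] /=.
    have := xI : x \in `](- V a)%R, (- V b)%R[%R.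
    rewrite !in_itv/= => /andP[Vax xVb].
    by rewrite ltrNr xVb ltrNl Vax.
  - move=> x; rewrite in_itv/= => /andP[Vax xVb]; apply: f0.
    by rewrite in_itv/= ltrNr xVb ltrNl Vax.
by under eq_integral do rewrite opprK.
Qed.

End substitution.

(** * From the transfer equation to an invariant density *)

Section invariance.
Context {R : realType} (n : nat).
Local Notation mu := (@lebesgue_measure R).
Local Open Scope ereal_scope.
Variables (S : R -> R) (I : 'I_n -> set R) (V J : 'I_n -> R -> R).
Hypothesis mS : measurable_fun setT S.
Hypothesis mI : forall i, measurable (I i).
Hypothesis tI : trivIset setT I.
Hypothesis I01 : forall i, I i `<=` `[0%R, 1%R].
Hypothesis cI : mu (`[0%R, 1%R]%classic `\` \big[setU/set0]_i I i) = 0.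
Hypothesis mV : forall i, measurable_fun setT (V i).
Hypothesis mJ : forall i, measurable_fun setT (J i).
Hypothesis J0 : forall i y, (0 <= J i y)%R.
Hypothesis SV : forall i y, y \in `]0%R, 1%R[%R -> S (V i y) = y.
Hypothesis subst : forall i (f : R -> \bar R),
  measurable_fun setT f -> (forall x, 0 <= f x) ->
  \int[mu]_(x in I i) f x = \int[mu]_(y in `]0%R, 1%R[) (f (V i y) * (J i y)%:E).

(** On the piece [I i] the condition [S x \in E] becomes [y \in E] once
[x = V i y] is substituted. *)
Lemma ge0_integral_preimage (g : R -> R) (E : set R) : measurable E ->
  measurable_fun setT g -> (forall x, 0 <= g x)%R ->
  \int[mu]_(x in (`[0%R, 1%R] : set R) `&` S @^-1` E) (g x)%:E =
  \int[mu]_(y in (`]0%R, 1%R[ : set R) `&` E) (\sum_i g (V i y) * J i y)%:E.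
Proof.
move=> mE mg g0; rewrite integral_mkcondr.
have mSE : measurable (S @^-1` E) by rewrite -[X in measurable X]setTI; exact: mS.
set g' := _ \_ _.
have mg' : measurable_fun setT g'.
  apply/measurable_restrict => //; rewrite setTI.
  by apply/measurable_EFinP; exact: measurable_funTS.
have g'0 x : 0 <= g' x by rewrite /g' patchE; case: ifPn => //; rewrite lee_fin.
pose U := \big[setU/set0]_i I i.
have cU : mu (`[0%R, 1%R]%classic `\` U) = 0 by exact: cI.
have mU : measurable U by exact: bigsetU_measurable.
have U01 : U `<=` `[0%R, 1%R].
  by rewrite /U; elim/big_ind: _ => // A B ? ?; rewrite subUset.
rewrite (ge0_negligible_integral _ _ _ _ cU)//; last 2 first.
  - exact: measurableD.
  - exact: measurable_funTS.
rewrite setDD (setIidr U01) ge0_integral_bigsetU//=; last 3 first.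
  - exact: index_enum_uniq.
  - exact: sub_trivIset tI.
  - exact: measurable_funTS.
transitivity (\sum_i \int[mu]_(y in (`]0%R, 1%R[ : set R) `&` E)
    (g (V i y) * J i y)%:E).
  apply: eq_bigr => i _; rewrite subst// integral_mkcondr.
  apply: eq_integral => y; rewrite inE => y01.
  rewrite /g' !patchE; case: ifPn => [|].
    by rewrite inE /preimage/= SV// => Ey; rewrite mem_set.
  by rewrite notin_setE /preimage/= SV// => Ey; rewrite memNset// mul0e.
rewrite -ge0_integral_sum//=.
- by apply: eq_integral => y _; rewrite sumEFin.
- by apply: measurableI => //; exact: mE.
- move=> i; apply/measurable_EFinP/measurable_funTS/measurable_funM; last exact: mJ.
  exact: (measurableT_comp mg (mV i)).
- by move=> i y _; rewrite lee_fin mulr_ge0.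
Qed.

(** Under the bound, [c = sum_i (h (V i y))^+ J i y - (h y)^+] satisfies
[0 <= c <= C]; by the transfer equation it is also the excess of the negative
parts.  The integral of [h] over the preimage of [E] is thus
[(u + w) - (v + w)] with [u], [v] the integrals of [h^+], [h^-] over [E],
possibly infinite, and [w] finite. *)
Lemma invariant_density_of_branches (h : R -> R) (C : R) :
  measurable_fun setT h ->
  {ae mu, forall y, y \in `]0%R, 1%R[%R -> (\sum_i h (V i y) * J i y)%R = h y} ->
  {ae mu, forall y, y \in `]0%R, 1%R[%R ->
    (\sum_i Num.max (h (V i y)) 0 * J i y <= Num.max (h y) 0 + C)%R} ->
  invariant_density S h.
Proof.
move=> mh PF bd; split; first exact: measurable_funTS.
move=> E mE E01.
pose D := (`]0%R, 1%R[%classic : set R) `&` E.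
have mD : measurable D by exact: measurableI.
have mpos (f : R -> R) : measurable_fun setT f ->
    measurable_fun setT (fun x => Num.max (f x) 0)%R.
  by move=> mf; exact: measurable_maxr.
pose p y := (\sum_i Num.max (h (V i y)) 0 * J i y)%R.
pose m y := (\sum_i Num.max (- h (V i y)) 0 * J i y)%R.
have mp : measurable_fun setT p.
  apply: measurable_sum => i; apply: measurable_funM => //; apply: mpos.
  exact: (measurableT_comp mh (mV i)).
have mm : measurable_fun setT m.
  apply: measurable_sum => i; apply: measurable_funM => //; apply: mpos.
  by apply: measurableT_comp => //; exact: measurableT_comp.
pose hp y := (Num.max (h y) 0)%R.
pose hm y := (Num.max (- h y) 0)%R.
have mhp : measurable_fun setT hp by exact: mpos.
have mhm : measurable_fun setT hm by apply: mpos; exact: measurableT_comp.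
(* The absolute value makes [c] nonnegative also on the exceptional null set. *)
pose c y := (`|p y - hp y|)%R.
have mc : measurable_fun setT c.
  by apply: measurableT_comp => //; exact: measurable_funB.
have aeF : Filter (nbhs (almost_everywhere mu)).
  exact: (ae_filter_ringOfSetsType mu).
have maxB (x : R) : (Num.max x 0 - Num.max (- x) 0 = x)%R.
  by case: (ltrP 0 x) => x0; case: (ltrP 0 (- x)) => Nx0; lra.
have key : {ae mu, forall y, D y ->
    [/\ hp y <= p y, m y = hm y + (p y - hp y) & p y <= hp y + C]%R}.
  apply: filterS2 PF bd => y + + [y01 _] => /(_ y01) PFy /(_ y01) bdy.
  have mph : (m y = p y - h y)%R.
    rewrite -PFy -sumrB; apply: eq_bigr => i _.
    by rewrite -[in X in (_ - X)%R](maxB (h (V i y))); ring.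
  have m0 : (0 <= m y)%R.
    by apply: sumr_ge0 => i _; rewrite mulr_ge0// le_max lexx orbT.
  have p0 : (0 <= p y)%R.
    by apply: sumr_ge0 => i _; rewrite mulr_ge0// le_max lexx orbT.
  split=> //; first by rewrite ge_max p0 andbT -subr_ge0 -mph.
  by rewrite mph -[in LHS](maxB (h y)) /hp /hm; ring.
have c0 y : (0 <= c y)%R by exact: normr_ge0.
have hp0 y : (0 <= hp y)%R by rewrite le_max lexx orbT.
have hm0 y : (0 <= hm y)%R by rewrite le_max lexx orbT.
have EDint (f : R -> R) : measurable_fun setT f ->
    \int[mu]_(x in E) (f x)%:E = \int[mu]_(x in D) (f x)%:E.
  move=> mf; have -> : D = (E `\ 0%R) `\ 1%R.
    apply/seteqP; split => [x [x01 Ex]|x [[Ex x0] x1]].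
      split; first split=> //.
        by move=> x0; move: x01; rewrite /= x0 in_itv/= ltxx.
      by move=> x1; move: x01; rewrite /= x1 in_itv/= ltxx andbF.
    split=> //; have := E01 x Ex; rewrite /= !in_itv/= => /andP[x0' x1'].
    rewrite !lt_neqAle x0' x1' !andbT; apply/andP; split; apply/eqP => //.
    exact/nesym.
  have mE0 : measurable (E `\ 0%R) by exact: measurableD.
  have mE1 : measurable ((E `\ 0%R) `\ 1%R) by exact: measurableD.
  rewrite !integral_setD1//; exact/measurable_EFinP/measurable_funTS.
have ints (f g : R -> R) : measurable_fun setT f -> measurable_fun setT g ->
    (forall x, 0 <= f x)%R -> (forall x, 0 <= g x)%R ->
    {ae mu, forall y, D y -> f y = (g y + c y)%R} ->
    \int[mu]_(x in D) (f x)%:E =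
    \int[mu]_(x in E) (g x)%:E + \int[mu]_(x in D) (c x)%:E.
  move=> mf mg f0 g0 fgc; rewrite EDint//.
  rewrite -ge0_integralD//; last 4 first.
  - by move=> x _; rewrite lee_fin.
  - by apply/measurable_EFinP/measurable_funTS; assumption.
  - by move=> x _; rewrite lee_fin.
  - by apply/measurable_EFinP/measurable_funTS; assumption.
  apply: ge0_ae_eq_integral => //.
  - by apply/measurable_EFinP/measurable_funTS; assumption.
  - by apply/measurable_EFinP/measurable_funTS; exact: measurable_funD.
  - by move=> x _; rewrite lee_fin.
  - by move=> x _; rewrite lee_fin addr_ge0.
  - by apply: filterS fgc => y fgcy Dy; rewrite fgcy.
have intp : \int[mu]_(x in D) (p x)%:E =
    \int[mu]_(x in E) (hp x)%:E + \int[mu]_(x in D) (c x)%:E.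
  apply: ints => //.
    by move=> y; apply: sumr_ge0 => i _; rewrite mulr_ge0// le_max lexx orbT.
  apply: filterS key => y + Dy => /(_ Dy)[hpp _ _].
  by rewrite /c ger0_norm ?subr_ge0// addrC subrK.
have intm : \int[mu]_(x in D) (m x)%:E =
    \int[mu]_(x in E) (hm x)%:E + \int[mu]_(x in D) (c x)%:E.
  apply: ints => //.
    by move=> y; apply: sumr_ge0 => i _; rewrite mulr_ge0// le_max lexx orbT.
  apply: filterS key => y + Dy => /(_ Dy)[hpp -> _].
  by rewrite /c ger0_norm ?subr_ge0.
have cfin : \int[mu]_(x in D) (c x)%:E \is a fin_num.
  rewrite ge0_fin_numE; last by apply: integral_ge0 => x _; rewrite lee_fin.
  apply: (@le_lt_trans _ _ (\int[mu]_(x in D) (`|C|%R)%:E)).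
    apply: ae_ge0_le_integral => //.
    - by move=> x _; rewrite lee_fin.
    - by apply/measurable_EFinP/measurable_funTS; assumption.
    - apply: filterS key => y + Dy => /(_ Dy)[hpp _ pC].
      rewrite lee_fin /c ger0_norm ?subr_ge0//.
      by rewrite (le_trans _ (ler_norm _))// lerBlDl.
  rewrite integral_cst//= lte_mul_pinfty//.
  rewrite (@le_lt_trans _ _ (mu `[0%R, 1%R]))//; last first.
    by rewrite lebesgue_measure_itv/=; case: ifP; rewrite ltry.
  by apply: le_measure; rewrite ?inE// => x [_ /E01].
rewrite integralE [RHS]integralE.
have posE : (EFin \o h)^\+ = EFin \o hp.
  by apply/funext => x; rewrite funeposE /= EFin_max.
have negE : (EFin \o h)^\- = EFin \o hm.
  by apply/funext => x; rewrite funenegE /= EFin_max EFinN.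
rewrite posE negE /=.
rewrite !ge0_integral_preimage//.
rewrite -/D intp intm.
have addeKC (u v w : \bar R) : w \is a fin_num -> 0 <= u -> 0 <= v ->
    u + w - (v + w) = u - v.
  case: w => [w| |]// _; case: u => [u| |]//; case: v => [v| |]// _ _.
  by congr EFin; ring.
by rewrite addeKC//; apply: integral_ge0 => x _; rewrite lee_fin.
Qed.

End invariance.

(** * Fractional linear maps and their matrices *)

Section fractional_linear.
Context {R : realType}.
Implicit Types (M : 'M[R]_2) (x y : R).

(** Inversion is continuous off [0], and a single point does not affect
measurability. *)
Lemma measurable_invr : measurable_fun setT (fun x : R => x^-1).
Proof.
have -> : [set: R] = [set x | x != 0] `|` [set 0].
  by apply/seteqP; split=> // x _ /=; case: (eqVneq x 0); [right|left].
have o0 : open [set x : R | x != 0] by exact: open_neq.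
apply/measurable_funU => //; first exact: open_measurable.
split; last exact: measurable_fun_set1.
apply: open_continuous_measurable_fun => //.
by move=> x; rewrite inE /= => x0; exact: inv_continuous.
Qed.

Lemma flmap_mx2 (a b c d x : R) : flmap (mx2 a b c d) x = (c + d * x) / (a + b * x).
Proof. by rewrite /flmap !mxE. Qed.

(** [a + b y] is the barycentre of its values at [0] and at [1]. *)
Lemma affine_gt0 (a b y : R) : 0 < a -> 0 < a + b -> y \in `[0, 1] -> 0 < a + b * y.
Proof.
move=> a0 ab0; rewrite in_itv/= => /andP[y0 y1].
rewrite (_ : a + b * y = (1 - y) * a + y * (a + b)); last by ring.
have [->|yn0] := eqVneq y 0; first by rewrite subr0 mul1r mul0r addr0.
have y_gt0 : 0 < y by rewrite lt_neqAle eq_sym yn0.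
by rewrite ltr_wpDl ?mulr_ge0 ?subr_ge0 ?(ltW a0)// mulr_gt0.
Qed.

Lemma measurable_flmap M : measurable_fun setT (flmap M).
Proof.
have maff (a b : R) : measurable_fun setT (fun x => a + b * x).
  by apply: measurable_funD => //; exact: measurable_funM.
apply: measurable_funM => //.
exact: (measurableT_comp measurable_invr (maff _ _)).
Qed.

Lemma sum_ord2 (V : nmodType) (F : 'I_2 -> V) : \sum_i F i = F 0 + F 1.
Proof.
by rewrite !big_ord_recl big_ord0 addr0; congr (F _ + F _); exact: val_inj.
Qed.

Lemma eq_mx2 (A B : 'M[R]_2) :
  A 0 0 = B 0 0 -> A 0 1 = B 0 1 -> A 1 0 = B 1 0 -> A 1 1 = B 1 1 -> A = B.
Proof.
move=> e00 e01 e10 e11; apply/matrixP => i j.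
have ord2 (k : 'I_2) : k = 0 \/ k = 1.
  by case: k => [[|[|//]]] p; [left|right]; exact: val_inj.
by case: (ord2 i) => ->; case: (ord2 j) => ->.
Qed.

(** [flmap M x] is the slope of the vector [M (1, x)^T], which reduces the claim
to the entries of [invmx M *m M = 1]. *)
Lemma flmapK M x : M \in unitmx -> M 0 0 + M 0 1 * x != 0 ->
  flmap (invmx M) (flmap M x) = x.
Proof.
move=> Mu u0; have := mulVmx Mu => /matrixP WM.
have := WM 0 0; have := WM 0 1; have := WM 1 0; have := WM 1 1.
rewrite !mxE !sum_ord2 => w11 w10 w01 w00.
rewrite /flmap; move: (invmx M) w11 w10 w01 w00 => W w11 w10 w01 w00.
have num : W 1 0 * (M 0 0 + M 0 1 * x) + W 1 1 * (M 1 0 + M 1 1 * x) = x.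
  rewrite (_ : _ + _ = (W 1 0 * M 0 0 + W 1 1 * M 1 0) +
                       (W 1 0 * M 0 1 + W 1 1 * M 1 1) * x); last by ring.
  by rewrite w10 w11 add0r mul1r.
have den : W 0 0 * (M 0 0 + M 0 1 * x) + W 0 1 * (M 1 0 + M 1 1 * x) = 1.
  rewrite (_ : _ + _ = (W 0 0 * M 0 0 + W 0 1 * M 1 0) +
                       (W 0 0 * M 0 1 + W 0 1 * M 1 1) * x); last by ring.
  by rewrite w00 w01 mul0r addr0.
move: (M 0 0 + M 0 1 * x) (M 1 0 + M 1 1 * x) u0 num den => u v u0 num den.
have -> : W 1 0 + W 1 1 * (v / u) = x / u by rewrite -num mulrDl mulfK// mulrA.
have -> : W 0 0 + W 0 1 * (v / u) = u^-1.
  by rewrite -[RHS]mul1r -den mulrDl mulfK// mulrA.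
by rewrite invrK divfK.
Qed.

Lemma det_mx2 M : \det M = M 0 0 * M 1 1 - M 0 1 * M 1 0.
Proof.
rewrite (expand_det_row _ 0) sum_ord2 /cofactor !det_mx11 !mxE.
rewrite (_ : lift 0 0 = 1); last exact/val_inj.
rewrite (_ : lift 1 0 = 0); last exact/val_inj.
by rewrite /= expr0 expr1 mul1r mulN1r mulrN.
Qed.

Lemma is_derive_flmap M (y : R) : M 0 0 + M 0 1 * y != 0 ->
  is_derive y 1 (flmap M) (\det M / (M 0 0 + M 0 1 * y) ^+ 2).
Proof.
move=> u0.
have aff (a b : R) : is_derive y 1 (fun z : R => a + b * z) b.
  have H : is_derive y 1 (cst a + b \*: (@id R)) (0 + b *: 1) by exact: is_deriveD.
  by move: H; rewrite add0r /GRing.scale /= mulr1.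
have := is_deriveM (aff (M 1 0) (M 1 1))
  (@is_deriveV _ (fun z => M 0 0 + M 0 1 * z) y _ _ u0 (aff (M 0 0) (M 0 1))).
move=> H; apply: (is_derive_eq H).
rewrite det_mx2 /GRing.scale /=; field.
exact: u0.
Qed.

(** The sign of [\det M] decides whether [flmap M] increases or decreases on
[[0, 1]], whence the minimum and maximum.  The translation [s] serves the outer
inverse branches, which are translates of the middle one. *)
Lemma ge0_integral_flmap M (s : R) (f : R -> \bar R) :
  let V x := flmap M x + s in
  let l := Num.min (V 0) (V 1) in let r := Num.max (V 0) (V 1) in
  0 < M 0 0 -> 0 < M 0 0 + M 0 1 -> \det M != 0 ->
  measurable_fun setT f -> (forall x, 0 <= f x)%E ->
  (\int[lebesgue_measure]_(x in `]l, r[) f x =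
  \int[lebesgue_measure]_(y in `]0%R, 1%R[)
    (f (V y) * (`|\det M| / (M 0 0 + M 0 1 * y) ^+ 2)%:E))%E.
Proof.
move=> V l r M0 M1 detM0 mf f0.
have u_gt0 (y : R) : y \in `[0, 1] -> 0 < M 0 0 + M 0 1 * y by exact: affine_gt0.
pose J y := \det M / (M 0 0 + M 0 1 * y) ^+ 2.
have dV (y : R) : y \in `[0, 1] -> is_derive y 1 V (J y).
  move=> y01; have H := is_derive_flmap (lt0r_neq0 (u_gt0 y y01)).
  have := @is_deriveD _ _ _ (flmap M) (cst s) y 1 _ 0 H (is_derive_cst _ _ _).
  by rewrite addr0.
have mV : measurable_fun setT V.
  by apply: measurable_funD => //; exact: measurable_flmap.
have cJ : {within `[0, 1], continuous J}.
  apply: continuous_in_subspaceT => y; rewrite inE /= => y01.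
  apply: cvgM; first exact: cvg_cst.
  apply: cvgV; first by rewrite expf_neq0// gt_eqF// u_gt0.
  have cu : {for y, continuous (fun z : R => M 0 0 + M 0 1 * z)}.
    by apply: cvgD; [exact: cvg_cst|apply: cvgM; [exact: cvg_cst|exact: cvg_id]].
  by rewrite /= expr2; apply: cvgM; exact: cu.
have V01 : V 1 - V 0 = \det M / (M 0 0 * (M 0 0 + M 0 1)).
  rewrite /V /flmap det_mx2 !mulr1 !mulr0 !addr0; field.
  by rewrite !gt_eqF.
have u2 (y : R) : y \in `]0, 1[ -> 0 < (M 0 0 + M 0 1 * y) ^+ 2.
  by move=> y01; rewrite exprn_gt0// u_gt0//; exact: subset_itv_oo_cc.
have [det_lt0|det_gt0] := ltP (\det M) 0.
  have V10 : V 1 < V 0 by rewrite -subr_lt0 V01 pmulr_llt0// invr_gt0 mulr_gt0.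
  rewrite /l /r (min_idPr (ltW V10)) (max_idPl (ltW V10)).
  rewrite (ge0_integral_comp_decreasing _ mV dV cJ)//.
  - by apply: eq_integral => y _; rewrite ltr0_norm// /J mulNr.
  - by move=> y y01; rewrite /J pmulr_llt0// invr_gt0 u2.
  - exact: measurable_funTS.
have {}det_gt0 : 0 < \det M by rewrite lt_neqAle eq_sym detM0.
have V10 : V 0 < V 1 by rewrite -subr_gt0 V01 divr_gt0// mulr_gt0.
rewrite /l /r (min_idPl (ltW V10)) (max_idPr (ltW V10)).
rewrite (ge0_integral_comp_increasing _ mV dV cJ)//.
- by apply: eq_integral => y _; rewrite gtr0_norm.
- by move=> y y01; rewrite /J divr_gt0// u2.
- exact: measurable_funTS.
Qed.

End fractional_linear.

(** * The jump transformation with increasing outer branches *)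

Section jump_transformation.
Context {R : realType} (beta : R) (s : sign).
Hypothesis beta_gt : -1 < beta.
Local Notation mu := (@lebesgue_measure R).
Local Notation t := (MapType Increasing s Increasing).
Local Notation Vb := (flmap (V_beta beta s)).

Let b1_gt0 : 0 < 1 + beta. Proof. by move: beta_gt; lra. Qed.

Let aff_gt0 (y : R) : y \in `[0, 1] -> 0 < 1 + beta * y.
Proof. exact: affine_gt0. Qed.

Lemma V_beta_den (y : R) :
  V_beta beta s 0 0 + V_beta beta s 0 1 * y = 3 * (1 + beta * y).
Proof. by case: s; rewrite !mxE /=; ring. Qed.

Let den (y : R) : y \in `[0, 1] -> V_beta beta s 0 0 + V_beta beta s 0 1 * y != 0.
Proof.
by move=> /aff_gt0 u0; rewrite V_beta_den mulf_neq0// gt_eqF.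
Qed.

Lemma det_V_beta : \det (V_beta beta s) =
  (if s is Increasing then 1 else -1) * (3 * (1 + beta)).
Proof. by case: s; rewrite det_mx2 !mxE /=; ring. Qed.

Lemma V_beta_unit : V_beta beta s \in unitmx.
Proof.
rewrite unitmxE unitfE det_V_beta.
have : 1 + beta != 0 by rewrite gt_eqF.
by case: s => b0; rewrite !mulf_neq0 ?oppr_eq0.
Qed.

Lemma V_beta_01 : Num.min (Vb 0) (Vb 1) = 1 / 3 /\ Num.max (Vb 0) (Vb 1) = 2 / 3.
Proof.
have b1 : 3 + 3 * beta != 0 by rewrite gt_eqF//; move: beta_gt; lra.
have lt12 : 1 / 3 <= 2 / 3 :> R by lra.
case: s; rewrite /V_beta !flmap_mx2 !mulr1 !mulr0 !addr0.
  have -> : (1 + (1 + 2 * beta)) / (3 + 3 * beta) = 2 / 3 by field.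
  by rewrite (min_idPl lt12) (max_idPr lt12).
have -> : (2 + (-1 + beta)) / (3 + 3 * beta) = 1 / 3 by field.
by rewrite (min_idPr lt12) (max_idPl lt12).
Qed.

Lemma V_beta_itv (y : R) : y \in `]0, 1[ -> 1 / 3 < Vb y < 2 / 3.
Proof.
move=> y01; have u0 : 0 < 1 + beta * y by apply/aff_gt0/subset_itv_oo_cc.
move: y01; rewrite in_itv/= => /andP[y0 y1].
have b1 := b1_gt0.
have v0 : 0 < 3 + 3 * beta * y by nra.
case: s; rewrite /V_beta flmap_mx2 ltr_pdivlMr// ltr_pdivrMr//; apply/andP; split; nra.
Qed.

Lemma T_map_V_beta (y : R) : y \in `]0, 1[ -> T_map beta t (Vb y) = y.
Proof.
move=> y01; have /andP[lo hi] := V_beta_itv y01.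
rewrite /T_map ltNge (ltW lo)/= (ltW hi).
by rewrite flmapK ?V_beta_unit// den// subset_itv_oo_cc.
Qed.

(** For [i = 0, 1, 2] the point [V_beta y + (i - 1) / 3] is the image of [y]
under the inverse branch of [S] onto the third starting at [i / 3]. *)
Lemma S_mapK (i : 'I_3) (y : R) : y \in `]0, 1[ ->
  S_map beta t (Vb y + (i%:R - 1) / 3) = y.
Proof.
move=> y01; have /andP[lo hi] := V_beta_itv y01.
have TV := T_map_V_beta y01.
have lt_alpha : Vb y - 1 / 3 < 1 / 3 by lra.
have gt_gamma : 2 / 3 < Vb y + 1 / 3 by lra.
have gt_gamma' : 1 / 3 < Vb y + 1 / 3 by lra.
case: i => [[|[|[|//]]]] /= _.
- rewrite (_ : _ + _ = Vb y - 1 / 3); last by rewrite sub0r mulN1r mul1r.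
  rewrite /S_map leNgt lt_alpha/=.
  suff -> : T_map beta t (Vb y - 1 / 3) = Vb y by [].
  rewrite /T_map lt_alpha.
  rewrite (_ : Vb y - _ = flmap (V_alpha R Increasing) (Vb y)); last first.
    by rewrite flmap_mx2 mul0r addr0; lra.
  rewrite flmapK//; first by rewrite unitmxE unitfE det_mx2 !mxE /= mul0r subr0 -natrM pnatr_eq0.
  by rewrite !mxE /= mul0r addr0 pnatr_eq0.
- rewrite subrr mul0r addr0 /S_map ifT//.
  by rewrite (ltW lo) (ltW hi).
- rewrite (_ : _ + _ = Vb y + 1 / 3); last by congr (_ + _ / _); lra.
  rewrite /S_map (leNgt _ (2 / 3)) gt_gamma andbF.
  suff -> : T_map beta t (Vb y + 1 / 3) = Vb y by [].
  rewrite /T_map ltNge (ltW gt_gamma') leNgt gt_gamma.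
  rewrite (_ : Vb y + _ = flmap (V_gamma R Increasing) (Vb y)); last first.
    by rewrite flmap_mx2 mul0r addr0; lra.
  rewrite flmapK//; first by rewrite unitmxE unitfE det_mx2 !mxE /= mul0r subr0 -natrM pnatr_eq0.
  by rewrite !mxE /= mul0r addr0 pnatr_eq0.
Qed.

Lemma measurable_T_map (t' : map_type) : measurable_fun setT (T_map beta t').
Proof.
apply: measurable_fun_ifT.
- exact: measurable_fun_ltr.
- exact: measurable_flmap.
- apply: measurable_fun_ifT.
  + exact: measurable_fun_ler.
  + exact: measurable_flmap.
  + exact: measurable_flmap.
Qed.

Lemma measurable_S_map (t' : map_type) : measurable_fun setT (S_map beta t').
Proof.
apply: measurable_fun_ifT.
- by apply: measurable_and; exact: measurable_fun_ler.
- exact: measurable_T_map.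
- exact: measurableT_comp (measurable_T_map t') (measurable_T_map t').
Qed.

(** Only the four points [i / 3] are left out. *)
Lemma thirds_cover :
  mu (`[0%R, 1%R]%classic `\`
    \big[setU/set0]_(i < 3) `](i%:R / 3 : R), (i.+1%:R / 3)[%classic) = 0%E.
Proof.
set N := _ `\` _.
have mN : measurable N.
  by apply: measurableD => //; apply: bigsetU_measurable => i _; exact: measurable_itv.
pose B : set R := (fun i => i%:R / 3) @` `I_4.
have cB : countable B by exact/finite_set_countable/finite_image/finite_II.
have mB : measurable B by exact: countable_measurable.
suff NB : N `<=` B.
  apply/eqP; rewrite eq_le measure_ge0 andbT -(countable_lebesgue_measure0 cB).
  by apply: le_measure; rewrite ?inE.
rewrite /N !big_ord_recl big_ord0 setU0 /= /bump /=.
move=> x [+ Nx]; rewrite /= in_itv/= => /andP[x0 x1].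
have [?|x0'] := eqVneq x 0; first by exists 0 => //=; lra.
have [?|x1'] := eqVneq x (1 / 3); first by exists 1%N => //=; lra.
have [?|x2'] := eqVneq x (2 / 3); first by exists 2%N => //=; lra.
have [?|x3'] := eqVneq x 1; first by exists 3%N => //=; lra.
exfalso; apply: Nx.
have [xl|xl] := ltP x (1 / 3); first left.
  by rewrite /= in_itv/=; apply/andP; split=> //; rewrite mul0r lt_neqAle eq_sym x0'.
right; have [xl'|xl'] := ltP x (2 / 3); [left|right]; rewrite /= in_itv/=.
  by rewrite xl' andbT lt_neqAle eq_sym x1' xl.
by rewrite lt_neqAle eq_sym x2' xl'/= (_ : 3 / 3 = 1) ?divff// lt_neqAle x3'.
Qed.

(** The exceptional point [p] leaves room for a pole of [h], where the value of
[h] is arbitrary and the transfer equation may fail. *)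
Lemma invariant_density_S_map (h : R -> R) (p C : R) :
  measurable_fun setT h ->
  (forall y, y \in `]0, 1[ -> y != p ->
    (h (Vb y - 1 / 3) + h (Vb y) + h (Vb y + 1 / 3)) *
      ((1 + beta) / (3 * (1 + beta * y) ^+ 2)) = h y) ->
  (forall y, y \in `]0, 1[ -> y != p ->
    (Num.max (h (Vb y - 1 / 3)) 0 + Num.max (h (Vb y)) 0
      + Num.max (h (Vb y + 1 / 3)) 0) *
      ((1 + beta) / (3 * (1 + beta * y) ^+ 2)) <= Num.max (h y) 0 + C) ->
  invariant_density (S_map beta t) h.
Proof.
move=> mh PF bd.
have b1 := b1_gt0.
pose J y := (1 + beta) / (3 * (1 + beta * y) ^+ 2).
have mJ : measurable_fun setT J.
  have mden : measurable_fun setT (fun y : R => 3 * (1 + beta * y) ^+ 2).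
    apply: measurable_funM => //; apply: measurable_funX.
    by apply: measurable_funD => //; exact: measurable_funM.
  by apply: measurable_funM => //; exact: (measurableT_comp measurable_invr mden).
have ae_p (P : R -> Prop) : (forall y, y != p -> P y) -> {ae mu, forall y, P y}.
  move=> HP; exists [set p]; split => //; first exact: lebesgue_measure_set1.
  by move=> y /= nPy; apply: contra_notP nPy => /eqP; exact: HP.
have sum3 (g : R -> R) y : \sum_(i < 3) g (Vb y + (i%:R - 1) / 3) * J y =
    (g (Vb y - 1 / 3) + g (Vb y) + g (Vb y + 1 / 3)) * J y.
  rewrite !big_ord_recl big_ord0 /= /bump /= addr0 -!mulrDl addrA.
  congr ((g _ + g _ + g _) * _); rewrite ?add1n ?addn0; lra.
apply: (@invariant_density_of_branches R 3 (S_map beta t)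
  (fun i => `](i%:R / 3 : R), (i.+1%:R / 3)[%classic)
  (fun i y => Vb y + (i%:R - 1) / 3) (fun i => J) _ _ _ _ _ _ _ _ _ _ h C) => //.
- exact: measurable_S_map.
- move=> i j _ _ [x []] /=; rewrite !in_itv/= => /andP[ix xi] /andP[jx xj].
  apply/val_inj/eqP; rewrite eqn_leq /= -ltnS -[in X in _ && X]ltnS -!(ltr_nat R).
  by apply/andP; split; lra.
- move=> i x /=; rewrite !in_itv/= => /andP[ix xi].
  have i0 : 0 <= i%:R :> R by [].
  have i3 : i.+1%:R <= 3 :> R by rewrite ler_nat.
  by apply/andP; split; lra.
- exact: thirds_cover.
- by move=> i; apply: measurable_funD => //; exact: measurable_flmap.
- by move=> i y; rewrite divr_ge0 ?(ltW b1)// mulr_ge0// sqr_ge0.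
- by move=> i y; exact: S_mapK.
- move=> i f mf f0.
  have := @ge0_integral_flmap R (V_beta beta s) ((i%:R - 1) / 3) f.
  have [V_min V_max] := V_beta_01.
  rewrite /= -addr_minl -addr_maxl V_min V_max.
  have -> : 1 / 3 + (i%:R - 1) / 3 = i%:R / 3 :> R by lra.
  have -> : 2 / 3 + (i%:R - 1) / 3 = i.+1%:R / 3 :> R by rewrite -natr1; lra.
  move=> -> //.
  + apply: eq_integral => y; rewrite inE /= => y01; congr (_ * _%:E)%E.
    have u0 : 1 + beta * y != 0 by rewrite gt_eqF// aff_gt0// subset_itv_oo_cc.
    rewrite det_V_beta V_beta_den normrM (gtr0_norm (mulr_gt0 _ b1))// /J.
    rewrite (_ : `|_| = 1); last by case: (s); rewrite ?normrN normr1.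
    by field.
  + by case: (s); rewrite !mxE.
  + have := V_beta_den 1; have -> : V_beta beta s 0 0 = 3 by case: (s); rewrite !mxE.
    by rewrite !mulr1 => ->; rewrite mulr_gt0.
  + rewrite det_V_beta; case: (s); rewrite mulf_neq0// ?oppr_eq0// gt_eqF// mulr_gt0//.
- apply: ae_p => y yp y01; rewrite sum3; exact: PF.
- apply: ae_p => y yp y01; rewrite (sum3 (fun x => Num.max (h x) 0)); exact: bd.
Qed.

End jump_transformation.

(** * Natural duals *)

(** For symmetric [M] the equation [M V = V^T M] says that [M V] is symmetric: one
linear equation in the entries [A], [B], [D] of [M].  Here [V_alpha V_beta] gives
[3 beta A + (beta - 2) B = 0] and [V_beta] gives
[3 beta A + (2 beta - 2) B = D]; the equation of [V_gamma V_beta] is a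
combination of these, so there is a solution, unique up to a factor. *)
Lemma natural_dual_increasing (R : realType) (beta : R) :
  -1 < beta -> beta != 0 ->
  has_natural_dual (S_inverse_branches beta (MapType Increasing Increasing Increasing)).
Proof.
move=> b1 b0; exists (mx2 (2 - beta) (3 * beta) (3 * beta) (3 * beta ^+ 2)); split.
- rewrite unitmxE unitfE det_mx2 !mxE /=.
  have b1' : 1 + beta != 0 by rewrite gt_eqF//; lra.
  rewrite (_ : _ - _ = - (3 * beta ^+ 2 * (1 + beta))); last by ring.
  by rewrite ?oppr_eq0 !mulf_neq0// expf_neq0.
- by apply: eq_mx2; rewrite !mxE.
- by move=> V; rewrite !inE => /or3P[] /eqP ->;
    apply: eq_mx2; rewrite !(mxE, sum_ord2) /=; ring.
Qed.

(** The equations are now [3 beta A = 4 B + D], from [V_alpha V_beta], and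
[3 beta A + (beta - 4) B = 2 D], from [V_beta]; their difference gives
[D = beta B]. *)
Lemma natural_dual_decreasing (R : realType) (beta : R) :
  -1 < beta -> beta != 0 ->
  has_natural_dual (S_inverse_branches beta (MapType Increasing Decreasing Increasing)).
Proof.
move=> b1 b0; exists (mx2 (4 + beta) (3 * beta) (3 * beta) (3 * beta ^+ 2)); split.
- rewrite unitmxE unitfE det_mx2 !mxE /=.
  have b1' : 1 + beta != 0 by rewrite gt_eqF//; lra.
  rewrite (_ : _ - _ = 3 * beta ^+ 2 * (1 + beta)); last by ring.
  by rewrite ?oppr_eq0 !mulf_neq0// expf_neq0.
- by apply: eq_mx2; rewrite !mxE.
- by move=> V; rewrite !inE => /or3P[] /eqP ->;
    apply: eq_mx2; rewrite !(mxE, sum_ord2) /=; ring.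
Qed.

(** * The two densities *)

(** The parameter is [c = 2 - beta] in type [[1, 1, 1]] and [c = 4] in type
[[1, -1, 1]]. *)
Definition dual_density (R : realType) (c beta x : R) : R :=
  ((c + 3 * beta * x) * (c + beta + 3 * beta * x))^-1.

Lemma measurable_dual_density (R : realType) (c beta : R) :
  measurable_fun setT (dual_density c beta).
Proof.
have maff (a b : R) : measurable_fun setT (fun x => a + b * x).
  by apply: measurable_funD => //; exact: measurable_funM.
by apply: (measurableT_comp (@measurable_invr R)); exact: measurable_funM.
Qed.

(** Moving [x] by [1/3] shifts both affine factors by [beta], so that consecutive
values share a factor and [telescope] applies to their sum. *)
Lemma dual_density_thirds (R : realType) (c beta z a : R) :
  a = c - beta + 3 * beta * z ->
  [/\ dual_density c beta (z - 1 / 3) = (a * (a + beta))^-1,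
      dual_density c beta z = ((a + beta) * (a + 2 * beta))^-1 &
      dual_density c beta (z + 1 / 3) = ((a + 2 * beta) * (a + 3 * beta))^-1].
Proof.
by move=> ->; split; congr (_ * _)^-1; lra.
Qed.

Lemma telescope (R : realType) (a b : R) :
  a != 0 -> a + b != 0 -> a + 2 * b != 0 -> a + 3 * b != 0 ->
  (a * (a + b))^-1 + ((a + b) * (a + 2 * b))^-1 +
    ((a + 2 * b) * (a + 3 * b))^-1 = 3 / (a * (a + 3 * b)).
Proof. by move=> a0 a1 a2 a3; field; rewrite a0 a1 a2 a3. Qed.

(** All the values of the density are positive here, so there is no cancellation
and the bound on positive parts is the transfer equation itself. *)
Lemma invariant_density_decreasing (R : realType) (beta : R) :
  -1 < beta ->
  invariant_density (S_map beta (MapType Increasing Decreasing Increasing))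
    (dual_density 4 beta).
Proof.
move=> b1'; set h := dual_density 4 beta; have b1 : 0 < 1 + beta by lra.
have PF (y : R) : y \in `]0, 1[ ->
    let z := flmap (V_beta beta Decreasing) y in
    [/\ 0 < h (z - 1 / 3), 0 < h z, 0 < h (z + 1 / 3), 0 < h y &
    (h (z - 1 / 3) + h z + h (z + 1 / 3)) *
      ((1 + beta) / (3 * (1 + beta * y) ^+ 2)) = h y].
  move=> y01 z; have y01' : y \in `[0, 1] by exact: subset_itv_oo_cc.
  have u0 : 0 < 1 + beta * y by exact: affine_gt0.
  have q1 : 0 < 4 + beta + 3 * beta * y by apply: affine_gt0 => //; lra.
  have q2 : 0 < 4 + 3 * beta * y by apply: affine_gt0 => //; lra.
  have m1 : 0 < 4 + 2 * beta + (3 * beta + beta ^+ 2) * y.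
    by apply: affine_gt0 => //; nra.
  have m2 : 0 < 4 + 3 * beta + (3 * beta + 2 * beta ^+ 2) * y.
    by apply: affine_gt0 => //; nra.
  have u1 := lt0r_neq0 u0.
  have zE : z = (2 + (beta - 1) * y) / (3 * (1 + beta * y)).
    by rewrite /z flmap_mx2; congr (_ / _); ring.
  pose a := 4 - beta + 3 * beta * z.
  rewrite /h; have [-> -> ->] := @dual_density_thirds _ 4 beta z a erefl.
  have a0E : a = (4 + beta + 3 * beta * y) / (1 + beta * y).
    by rewrite /a zE; field.
  have a1E : a + beta = (4 + 2 * beta + (3 * beta + beta ^+ 2) * y) / (1 + beta * y).
    by rewrite /a zE; field.
  have a2E : a + 2 * beta =
      (4 + 3 * beta + (3 * beta + 2 * beta ^+ 2) * y) / (1 + beta * y).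
    by rewrite /a zE; field.
  have a3E : a + 3 * beta = (1 + beta) * (4 + 3 * beta * y) / (1 + beta * y).
    by rewrite /a zE; field.
  have a0 : 0 < a by rewrite a0E divr_gt0.
  have a1 : 0 < a + beta by rewrite a1E divr_gt0.
  have a2 : 0 < a + 2 * beta by rewrite a2E divr_gt0.
  have a3 : 0 < a + 3 * beta by rewrite a3E divr_gt0// mulr_gt0.
  split; rewrite ?invr_gt0 ?mulr_gt0//.
  rewrite telescope ?lt0r_neq0// a3E a0E /dual_density.
  by field; rewrite u1 !lt0r_neq0.
apply: (@invariant_density_S_map _ _ _ b1' h 0 0).
- exact: measurable_dual_density.
- by move=> y /PF[].
- by move=> y /PF[/ltW/max_idPl-> /ltW/max_idPl-> /ltW/max_idPl-> /ltW/max_idPl-> ->] _;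
    rewrite addr0.
Qed.

(** Only the factor [2 + 3 beta y] can vanish or change sign on [(0, 1)], and it
enters [h y] and [h (z + 1 / 3)] alone.  Where [h y] is positive all three
branches contribute positively; where it is negative, the positive
contributions come from the first two branches and sum up to
[2 (1 + beta) / (3 (2 - beta + 3 beta y) m)], with [m] the numerator of
[a + 2 beta].  Then [beta < 0], so both factors of the denominator decrease on
[[0, 1]]; their values [2 (1 + beta)] and [2 (1 + beta)^2] at [1] give the
constant. *)
Lemma invariant_density_increasing (R : realType) (beta : R) :
  -1 < beta -> beta <= 2 -> beta != 0 ->
  invariant_density (S_map beta (MapType Increasing Increasing Increasing))
    (dual_density (2 - beta) beta).
Proof.
move=> b1' b2 b0; set h := dual_density (2 - beta) beta.
have b1 : 0 < 1 + beta by lra.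
have PF (y : R) : y \in `]0, 1[ -> y != - (2 / (3 * beta)) ->
    let z := flmap (V_beta beta Increasing) y in
    let J := (1 + beta) / (3 * (1 + beta * y) ^+ 2) in
    [/\ 0 < h (z - 1 / 3), 0 < h z, (0 < h (z + 1 / 3)) = (0 < h y),
    (h (z - 1 / 3) + h z + h (z + 1 / 3)) * J = h y &
    h y <= 0 -> (h (z - 1 / 3) + h z) * J <= (6 * (1 + beta) ^+ 2)^-1].
  move=> y01 yp z J; have y01' : y \in `[0, 1] by exact: subset_itv_oo_cc.
  have u0 : 0 < 1 + beta * y by exact: affine_gt0.
  have q1 : 0 < 2 - beta + 3 * beta * y.
    by move: y01; rewrite in_itv/= => /andP[y0 y1]; nra.
  have q2 : 2 + 3 * beta * y != 0.
    apply: contra_neq yp => H; have -> : 2 = - (3 * beta * y) by lra.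
    by field.
  have m1 : 0 < 2 + (3 * beta + beta ^+ 2) * y.
    by apply: affine_gt0 => //; nra.
  have m2 : 0 < 2 + beta + (3 * beta + 2 * beta ^+ 2) * y.
    by apply: affine_gt0 => //; nra.
  have u1 := lt0r_neq0 u0.
  have zE : z = (1 + (1 + 2 * beta) * y) / (3 * (1 + beta * y)).
    by rewrite /z flmap_mx2; congr (_ / _); ring.
  pose a := 2 - beta - beta + 3 * beta * z.
  rewrite /h; have [-> -> ->] := @dual_density_thirds _ (2 - beta) beta z a erefl.
  have a0E : a = (2 - beta + 3 * beta * y) / (1 + beta * y).
    by rewrite /a zE; field.
  have a1E : a + beta = (2 + (3 * beta + beta ^+ 2) * y) / (1 + beta * y).
    by rewrite /a zE; field.
  have a2E : a + 2 * beta =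
      (2 + beta + (3 * beta + 2 * beta ^+ 2) * y) / (1 + beta * y).
    by rewrite /a zE; field.
  have a3E : a + 3 * beta = (1 + beta) * (2 + 3 * beta * y) / (1 + beta * y).
    by rewrite /a zE; field.
  have a0 : 0 < a by rewrite a0E divr_gt0.
  have a1 : 0 < a + beta by rewrite a1E divr_gt0.
  have a2 : 0 < a + 2 * beta by rewrite a2E divr_gt0.
  have a3 : a + 3 * beta != 0.
    by rewrite a3E !mulf_neq0// ?invr_eq0// lt0r_neq0.
  have hyE : dual_density (2 - beta) beta y = ((2 - beta + 3 * beta * y) * (2 + 3 * beta * y))^-1.
    by rewrite /dual_density subrK.
  split.
  - by rewrite invr_gt0 mulr_gt0.
  - by rewrite invr_gt0 mulr_gt0.
  - rewrite hyE !invr_gt0 !pmulr_rgt0// a3E -mulrA pmulr_rgt0// pmulr_lgt0//.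
    by rewrite invr_gt0.
  - rewrite (telescope (lt0r_neq0 a0) (lt0r_neq0 a1) (lt0r_neq0 a2) a3).
    rewrite a3E a0E hyE /J.
    by field; rewrite u1 q2 !lt0r_neq0.
  - rewrite hyE invr_le0 pmulr_rle0// => q2_le0.
    have beta_lt0 : beta < 0.
      rewrite ltNge; apply/negP => beta_ge0; move: q2_le0; rewrite leNgt => /negP; apply.
      by rewrite ltr_wpDr// mulr_ge0 ?mulr_ge0//; move: y01'; rewrite in_itv => /andP[].
    have [y0 y1] : 0 <= y /\ y <= 1 by move: y01'; rewrite in_itv => /andP[].
    have q1_ge : 2 * (1 + beta) <= 2 - beta + 3 * beta * y by nra.
    have m2_ge : 2 * (1 + beta) ^+ 2 <= 2 + beta + (3 * beta + 2 * beta ^+ 2) * y.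
      by nra.
    have -> : ((a * (a + beta))^-1 + ((a + beta) * (a + 2 * beta))^-1) =
        2 / (a * (a + 2 * beta)) by field; rewrite !lt0r_neq0.
    rewrite a2E a0E /J.
    move: q1 m2 q1_ge m2_ge.
    move: (2 - beta + 3 * beta * y) (2 + beta + (3 * beta + 2 * beta ^+ 2) * y).
    move=> v w v0 w0 v_ge w_ge.
    rewrite (_ : _ * _ = 2 * (1 + beta) / (3 * (v * w))); last first.
      by field; rewrite u1 !lt0r_neq0.
    rewrite ler_pdivrMr ?mulr_gt0// [leRHS]mulrC ler_pdivlMr ?mulr_gt0 ?exprn_gt0//.
    have : 2 * (1 + beta) * (2 * (1 + beta) ^+ 2) <= v * w.
      by apply: ler_pM => //; rewrite mulr_ge0// ?exprn_ge0// ltW.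
    lra.
apply: (@invariant_density_S_map _ _ _ b1' h (- (2 / (3 * beta))) (6 * (1 + beta) ^+ 2)^-1).
- exact: measurable_dual_density.
- by move=> y y01 yp; have [] := PF y y01 yp.
- move=> y y01 yp; have [h0 h1 h2 hE hC] := PF y y01 yp.
  rewrite (max_idPl (ltW h0)) (max_idPl (ltW h1)).
  have [hy0|hy0] := ltP 0 (h y).
    rewrite (max_idPl _); last by rewrite ltW// h2.
    by rewrite hE lerDl invr_ge0 mulr_ge0// exprn_ge0// ltW.
  rewrite (max_idPr _); last by rewrite leNgt h2 -leNgt.
  by rewrite addr0 add0r hC.
Qed.

(** * Invariant densities and natural duals of the two types *)

Theorem theorem1 (R : realType) (beta : R)
    (hbeta_gt : -1 < beta) (hbeta_le : beta <= 2) (hbeta_neq0 : beta != 0) :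
  (let t := MapType Increasing Increasing Increasing in
   let h := fun x : R =>
     ((2 - beta + 3 * beta * x) * (2 + 3 * beta * x))^-1 in
   [/\ has_natural_dual (S_inverse_branches beta t),
       invariant_density (S_map beta t) h &
       - (2 / 3) <= beta -> forall x, 0 <= x <= 1 -> 0 <= h x])
  /\
  (let t := MapType Increasing Decreasing Increasing in
   let h := fun x : R =>
     ((4 + beta + 3 * beta * x) * (4 + 3 * beta * x))^-1 in
   [/\ has_natural_dual (S_inverse_branches beta t),
       invariant_density (S_map beta t) h &
       forall x, 0 <= x <= 1 -> 0 <= h x]).
Proof.
split=> /=.
  split; first exact: natural_dual_increasing.
    rewrite [X in invariant_density _ X](_ : _ = dual_density (2 - beta) beta).
      exact: invariant_density_increasing.
    by apply/funext => x; rewrite /dual_density subrK.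
  move=> b x /andP[x0 x1]; rewrite invr_ge0 mulr_ge0//; nra.
split; first exact: natural_dual_decreasing.
  rewrite [X in invariant_density _ X](_ : _ = dual_density 4 beta).
    exact: invariant_density_decreasing.
  by apply/funext => x; rewrite /dual_density mulrC.
move=> x x01; have x01' : x \in `[0, 1] by rewrite in_itv.
by rewrite invr_ge0 mulr_ge0// ltW// affine_gt0//; lra.
Qed.
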